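(* Let $K/k$ be a separable field extension of degree $6$ and $\widetilde{K}/k$ its Galois closure. If $\operatorname{Gal}(\widetilde{K}/k)=F_{36}$, then $K/k$ is not Hopf Galois.
   Context: $F_{36}$ denotes the transitive permutation group $6T10$ of degree $6$ and order $36$; abstractly it is $(C_3\times C_3)\rtimes C_4$ with $C_4$ acting faithfully (a generator acting as an element of order $4$ of $\mathrm{GL}_2(\mathbb{F}_3)$ whose square is $-1$). The Galois group $G=\operatorname{Gal}(\widetilde{K}/k)$ is viewed as a transitive permutation group of degree $6$ via left translation on $G/\operatorname{Gal}(\widetilde{K}/K)$. A finite extension of fields $L/k$ is called Hopf Galois if there exists a finite cocommutative $k$-Hopf algebra $H$ such that $L$ is an $H$-module algebra and the $k$-linear map $j: L\otimes_k H\to \operatorname{End}_k(L)$, $j(s\otimes h)(t)=s(ht)$ for $h\in H$, $s,t\in L$, is bijective. *)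

(* Defs.v *)
From HB Require Import structures.
From mathcomp Require Import all_boot all_order all_algebra.
From mathcomp Require Import all_fingroup all_solvable all_field.

Set Implicit Arguments.
Unset Strict Implicit.
Unset Printing Implicit Defensive.

Import GroupScope GRing.Theory VectorInternalTheory.
Local Open Scope ring_scope.

(* Tensor products of finite-dimensional vector spaces.  Elements are         *)
(* coefficient matrices with respect to the bases [tbasis]; the universal     *)
(* property is proved in [tens_universal] below.                              *)

Section Tensor.
Variable k : fieldType.
Implicit Types U V W : vectType k.

Definition tbasis V (i : 'I_(dim V)) : V := r2v (delta_mx 0 i).

Definition tens V W : vectType k := 'M[k]_(dim V, dim W).

Definition tpure V W (v : V) (w : W) : tens V W := (v2r v)^T *m v2r w.

Definition tlift V W U (b : V -> W -> U) (t : tens V W) : U :=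
  \sum_i \sum_j (t : 'M_(_, _)) i j *: b (tbasis i) (tbasis j).

Lemma tbasis_sum V (v : V) : v = \sum_i v2r v 0 i *: tbasis i.
Proof.
apply: v2r_inj; rewrite {1}[v2r v]row_sum_delta linear_sum.
by apply: eq_bigr => i _; rewrite linearZ /= /tbasis r2vK.
Qed.

Lemma tpure_basis V W (i : 'I_(dim V)) (j : 'I_(dim W)) :
  tpure (tbasis i) (tbasis j) = delta_mx i j.
Proof. by rewrite /tpure /tbasis !r2vK trmx_delta mul_delta_mx. Qed.

Lemma tpureDl V W (v v' : V) (w : W) a :
  tpure (a *: v + v') w = a *: tpure v w + tpure v' w.
Proof. by rewrite /tpure !linearP /= mulmxDl scalemxAl. Qed.

Lemma tpureDr V W (v : V) (w w' : W) a :
  tpure v (a *: w + w') = a *: tpure v w + tpure v w'.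
Proof. by rewrite /tpure !linearP. Qed.

Lemma tlift_is_linear V W U (b : V -> W -> U) : linear (tlift b).
Proof.
move=> a s t; rewrite /tlift scaler_sumr -big_split /=.
apply: eq_bigr => i _; rewrite scaler_sumr -big_split /=.
by apply: eq_bigr => j _; rewrite !mxE scalerDl scalerA.
Qed.

Lemma tens_universal V W U (b : V -> W -> U) :
    (forall w, linear (b^~ w)) -> (forall v, linear (b v)) ->
  linear (tlift b) /\ (forall v w, tlift b (tpure v w) = b v w) /\
  forall f : {linear tens V W -> U},
    (forall v w, f (tpure v w) = b v w) -> f =1 tlift b.
Proof.
move=> bl br; split; [exact: tlift_is_linear | split=> [v w|f fE t]].
  pose bL w := GRing.isLinear.Build k V U *:%R (b^~ w) (bl w).
  pose bR v := GRing.isLinear.Build k W U *:%R (b v) (br v).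
  pose BL w : {linear V -> U} := HB.pack (b^~ w) (bL w).
  pose BR v : {linear W -> U} := HB.pack (b v) (bR v).
  rewrite -[b v w]/(BL w v) {2}[v]tbasis_sum linear_sum.
  apply: eq_bigr => i _; rewrite linearZ_LR /= -[b _ w]/(BR (tbasis i) w).
  rewrite {2}[w]tbasis_sum linear_sum scaler_sumr; apply: eq_bigr => j _.
  by rewrite linearZ_LR /= scalerA !mxE big_ord1 !mxE.
rewrite {1}[t]matrix_sum_delta linear_sum; apply: eq_bigr => i _.
rewrite linear_sum; apply: eq_bigr => j _.
by rewrite linearZ_LR -tpure_basis fE.
Qed.

Definition tmap V W V' W' (f : V -> V') (g : W -> W') : tens V W -> tens V' W' :=
  tlift (fun v w => tpure (f v) (g w)).

Definition tassoc U V W : tens (tens U V) W -> tens U (tens V W) :=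
  tlift (fun uv w => tlift (fun u v => tpure u (tpure v w)) uv).

Definition tswap V W : tens V W -> tens W V := tlift (fun v w => tpure w v).

End Tensor.

(* The multiplication (a (x) b)(c (x) d) = ac (x) bd of A (x) B. *)
Definition tmul (k : fieldType) (A B : falgType k) (s t : tens A B) : tens A B :=
  tlift (fun a b => tlift (fun c d => tpure (a * c) (b * d)) t) s.

(* A [falgType k] is exactly a finite-dimensional nonzero k-algebra. *)
Record hopf_algebra (k : fieldType) (H : falgType k) := HopfAlgebra {
  comul : 'Hom(H, tens H H);
  counit : 'Hom(H, k^o);
  antipode : 'Hom(H, H);
  comul_coassoc : forall h : H,
    tassoc (tmap comul idfun (comul h)) = tmap idfun comul (comul h);
  counit_l : forall h : H, tlift (fun x y => counit x *: y) (comul h) = h;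
  counit_r : forall h : H, tlift (fun x y => counit y *: x) (comul h) = h;
  comul1 : comul 1 = tpure 1 1;
  comulM : forall x y : H, comul (x * y) = tmul (comul x) (comul y);
  counit1 : counit 1 = 1;
  counitM : forall x y : H, counit (x * y) = counit x * counit y;
  antipode_l : forall h : H,
    tlift (fun x y => antipode x * y) (comul h) = (counit h)%:A;
  antipode_r : forall h : H,
    tlift (fun x y => x * antipode y) (comul h) = (counit h)%:A
}.

Definition cocommutative (k : fieldType) (H : falgType k) (hH : hopf_algebra H) :=
  forall h : H, tswap (comul hH h) = comul hH h.

Definition module_algebra (k : fieldType) (H : falgType k) (hH : hopf_algebra H)
    (L : falgType k) (act : 'Hom(H, 'End(L))) : Prop :=
  [/\ forall t : L, act 1 t = t,
      forall (x y : H) (t : L), act (x * y) t = act x (act y t),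
      forall h : H, act h 1 = (counit hH h)%:A
    & forall (h : H) (s t : L),
        act h (s * t) = tlift (fun x y => act x s * act y t) (comul hH h)].

(* j (s (x) h) = (t |-> s * (h t)) *)
Definition galois_map (k : fieldType) (H L : falgType k)
    (act : 'Hom(H, 'End(L))) : tens L H -> 'End(L) :=
  tlift (fun s h => (amull s \o act h)%VF).

Definition hopf_galois (k : fieldType) (L : fieldExtType k) : Prop :=
  exists (H : falgType k) (hH : hopf_algebra H) (act : 'Hom(H, 'End(L))),
    [/\ cocommutative hH, module_algebra hH act & bijective (galois_map act)].

(* The ambient field is the Galois closure of K over the base field k. *)
Definition is_galois_closure (k : fieldType) (L : splittingFieldType k)
    (K : {subfield L}) : Prop :=
  galois 1 {:L} /\
  forall E : {subfield L}, (K <= E)%VS -> galois 1 E -> (E = fullv :> {vspace L}).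

(* F is, up to a numbering of S, the group of permutations of S induced by G. *)
Definition induces_perm_group (aT : finGroupType) (rT : finType)
    (to : {action aT &-> rT}) (G : {set aT}) (S : {set rT})
    (n : nat) (F : {set 'S_n}) : Prop :=
  exists f : 'I_n -> rT,
    [/\ injective f, f @: [set: 'I_n] = S
      & forall s : 'S_n,
          s \in F <-> exists2 g, g \in G & forall i, f (s i) = to (f i) g].

(* The composition law on [gal_of E] is (x * y) a = y (x a), opposite to the  *)
(* usual one.  The left cosets of Gal(L/K), permuted by left translation, are *)
(* thus the MathComp right cosets, permuted by right translation ['Rs].       *)
Definition galois_perm_group_is (k : fieldType) (L : splittingFieldType k)
    (K : {subfield L}) (n : nat) (F : {set 'S_n}) : Prop :=
  induces_perm_group 'Rs 'Gal({:L} / 1)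
    (rcosets 'Gal({:L} / K) 'Gal({:L} / 1)) F.

(* 6T10, generated by (0 1 2) and c = (0 3 1 4)(2 5).  The conjugate of       *)
(* (0 1 2) by c is a 3-cycle on {3, 4, 5}, and c ^+ 2 = (0 1)(3 4) inverts    *)
(* both 3-cycles.  Permutations compose left to right.                        *)
Definition F36 : {group 'S_6} :=
  let t (i j : nat) : 'S_6 := tperm (inord i) (inord j) in
  let a := (t 0%N 1%N * t 0%N 2%N)%g in
  let c := (t 0%N 3%N * t 0%N 1%N * t 0%N 4%N * t 2%N 5%N)%g in
  <<[set a; c]>>%G.

(* Main.v *)
(** Let [X] be the set of the six embeddings of [K] into [Kt].  Extending
    scalars to [Kt] turns [K] into the algebra of [Kt]-valued functions on [X].
    Bijectivity of the Galois map says that, for each [x] in [X], evaluating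
    the action at [x] identifies [Kt (x) H] with the space of [k]-linear maps
    from [K] to [Kt].  So for [x], [y] in [X] a unique [c] in [Kt (x) H] carries
    [x] to [y]; as [x] and [y] are multiplicative, [c] is grouplike, hence
    carries every embedding to an embedding.  The maps of [X] obtained in this
    way form a sharply transitive family [N] containing the identity, and by
    Galois descent [N] is stable under conjugation by the Galois group (one half
    of the Greither-Pareigis correspondence).

    No such family exists for F36.  An [s] in F36 commutes with any [n] in [N]
    as soon as [n (s i) = s (n i)] for one [i].  Let [c = (0 3 1 4)(2 5)], and
    let [n] be the member of [N] with [n 2 = 5].  Since [c ^+ 2] fixes 2 and 5,
    it commutes with [n], whence [n 5 = 2]; then [c] commutes with [n] too, so
    that [n 0] determines [n], and in each of the six cases one contradicts sharp
    transitivity by comparing [n] with the identity, with its conjugate by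
    [(0 1 2)] or with its conjugate by [(0 1 2)(3 4 5)]. *)

Require Import Defs.
From HB Require Import structures.
From mathcomp Require Import all_boot all_order all_algebra.
From mathcomp Require Import all_fingroup all_solvable all_field.

Set Implicit Arguments.
Unset Strict Implicit.
Unset Printing Implicit Defensive.

Import GroupScope GRing.Theory VectorInternalTheory.
Local Open Scope ring_scope.

(** * The group [F36] acting on six points *)

Lemma tpermE (T : finType) (x y z : T) :
  tperm x y z = if z == x then y else if z == y then x else z.
Proof.
by case: tpermP => [->|->|/eqP/negPf -> /eqP/negPf ->]; rewrite ?eqxx //;
  case: eqP.
Qed.

Lemma ord6P (i : 'I_6) (o := inord : nat -> 'I_6) :
  [\/ [\/ i = o 0%N, i = o 1%N | i = o 2%N]
    | [\/ i = o 3%N, i = o 4%N | i = o 5%N]].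
Proof.
rewrite -(inord_val i); case: i => [[|[|[|[|[|[|//]]]]]] ?] /=;
by [do 2 constructor | left; constructor 3 | right; constructor 3].
Qed.

Lemma eq_inord6 (i j : nat) :
  (i < 6)%N -> (j < 6)%N -> (inord i == inord j :> 'I_6) = (i == j).
Proof. by move=> ? ?; rewrite -val_eqE /= !inordK. Qed.

Lemma F36_gen (o := inord : nat -> 'I_6) :
  exists a b c : 'S_6, [/\ a \in F36, b \in F36 & c \in F36] /\
  [/\ [/\ a (o 0%N) = o 1%N, a (o 1%N) = o 2%N & a (o 2%N) = o 0%N]
    , [/\ a (o 3%N) = o 3%N, a (o 4%N) = o 4%N & a (o 5%N) = o 5%N]
    , [/\ b (o 0%N) = o 0%N, b (o 1%N) = o 1%N & b (o 2%N) = o 2%N]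
    & [/\ b (o 3%N) = o 4%N, b (o 4%N) = o 5%N & b (o 5%N) = o 3%N]] /\
  [/\ c (o 0%N) = o 3%N, c (o 1%N) = o 4%N & c (o 2%N) = o 5%N] /\
  [/\ c (o 3%N) = o 1%N, c (o 4%N) = o 0%N & c (o 5%N) = o 2%N].
Proof.
pose a := (tperm (o 0%N) (o 1%N) * tperm (o 0%N) (o 2%N))%g.
pose c := (tperm (o 0%N) (o 3%N) * tperm (o 0%N) (o 1%N) * tperm (o 0%N) (o 4%N)
           * tperm (o 2%N) (o 5%N))%g.
have Fa : a \in F36 by rewrite mem_gen // !inE eqxx.
have Fc : c \in F36 by rewrite mem_gen // !inE eqxx orbT.
have [[a0 a1 a2] [a3 a4 a5]] :
     [/\ a (o 0%N) = o 1%N, a (o 1%N) = o 2%N & a (o 2%N) = o 0%N]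
  /\ [/\ a (o 3%N) = o 3%N, a (o 4%N) = o 4%N & a (o 5%N) = o 5%N].
  by split; split; rewrite !permM; do !rewrite tpermE ?eq_inord6 //=.
have [[c0 c1 c2] [c3 c4 c5]] :
     [/\ c (o 0%N) = o 3%N, c (o 1%N) = o 4%N & c (o 2%N) = o 5%N]
  /\ [/\ c (o 3%N) = o 1%N, c (o 4%N) = o 0%N & c (o 5%N) = o 2%N].
  by split; split; rewrite !permM; do !rewrite tpermE ?eq_inord6 //=.
(* Since [c] carries 0, 1, 2 to 3, 4, 5 in this order, the conjugate [a ^ c] is the 3-cycle on the
   second block. *)
exists a, (a ^ c)%g, c; split; first by rewrite groupJ.
have b3 : (a ^ c)%g (o 3%N) = o 4%N by rewrite -c0 permJ a0 c1.
have b4 : (a ^ c)%g (o 4%N) = o 5%N by rewrite -c1 permJ a1 c2.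
have b5 : (a ^ c)%g (o 5%N) = o 3%N by rewrite -c2 permJ a2 c0.
have b1 : (a ^ c)%g (o 1%N) = o 1%N by rewrite -c3 permJ a3.
have b2 : (a ^ c)%g (o 2%N) = o 2%N by rewrite -{1}c5 permJ a5.
have b0 : (a ^ c)%g (o 0%N) = o 0%N by rewrite -c4 permJ a4.
by do !split.
Qed.

Lemma F36_no_regular_family (N : ('I_6 -> 'I_6) -> Prop) :
    (forall i j, exists2 n, N n & n i = j) ->
    (forall n n' i, N n -> N n' -> n i = n' i -> n =1 n') ->
    N id ->
    (forall s n, s \in F36 -> N n ->
      exists2 n', N n' & forall i, n' (s i) = s (n i)) ->
  False.
Proof.
move=> Ntrans Nfree Nid Nconj.
(* The conjugate [n'] agrees with [n] at the point [s i], so freeness makes them equal. *)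
have comm s n i : s \in F36 -> N n -> n (s i) = s (n i) ->
    forall j, n (s j) = s (n j).
  move=> Fs Nn ni j; have [n' Nn' n'E] := Nconj s n Fs Nn.
  by rewrite (Nfree n n' (s i)) // n'E.
pose o (i : nat) : 'I_6 := inord i.
have neq i j : (i < 6)%N -> (j < 6)%N -> i != j -> o i <> o j.
  by move=> ? ? ij /eqP; rewrite eq_inord6 // (negPf ij).
have [a [b [c [[Fa Fb Fc] [[[a0 a1 a2] [a3 a4 a5] [b0 b1 b2] [b3 b4 b5]]
  [[c0 c1 c2] [c3 c4 c5]]]]]]] := F36_gen.
have [n Nn n2] := Ntrans (o 2%N) (o 5%N).
have n5 : n (o 5%N) = o 2%N.
  have cc : forall j, n ((c * c)%g j) = (c * c)%g (n j).
    apply: (comm _ _ (o 2%N)) => //; first exact: groupM.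
    by rewrite !permM !(c2, c5, n2).
  have: n (o 5%N) <> o 5%N.
    by move/(Nfree _ id)=> /(_ Nn Nid)/(_ (o 2%N)); rewrite n2; apply: neq.
  (* [n 5] is fixed by [c ^+ 2], whose only fixed points are 2 and 5. *)
  have := cc (o 5%N); rewrite !permM c5 c2.
  by case: (ord6P (n (o 5%N))) => -[] ->;
    rewrite ?(c0, c1, c2, c3, c4, c5) // => /neq; case.
have nc : forall j, n (c j) = c (n j).
  by apply: (comm _ _ (o 2%N)); rewrite // c2 n5 n2 c5.
have := nc (o 0%N); rewrite c0 => n3.
have := nc (o 3%N); rewrite c3 n3 => n1.
have := nc (o 1%N); rewrite c1 n1 => n4.
have nab i : n (a (b i)) = a (b (n i)) -> forall j, n (a (b j)) = a (b (n j)).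
  move=> ni j; have := comm (b * a)%g n i (groupM Fb Fa) Nn.
  by rewrite !permM => /(_ ni j); rewrite !permM.
have na i : n (a i) = a (n i) -> forall j, n (a j) = a (n j) by exact: comm.
(* If [n 0 = 0], then [n] is the identity, against [n 2 = 5]. Otherwise [n] commutes at one point,
   hence everywhere, with [a] (values 1, 2, 5) or [b * a] (values 3, 4); a second point refutes
   this. *)
case: (ord6P (n (o 0%N))) => -[] n0;
  rewrite n0 !(c0, c1, c2, c3, c4, c5) in n1 n3 n4.
- move: (Nfree _ id _ Nn Nid n0 (o 2%N)); rewrite n2; exact: neq.
- move: (na (o 3%N)); rewrite a3 n3 a4 => /(_ erefl)/(_ (o 2%N)).
  rewrite a2 n0 n2 a5; exact: neq.
- move: (na (o 3%N)); rewrite a3 n3 a5 => /(_ erefl)/(_ (o 2%N)).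
  rewrite a2 n0 n2 a5; exact: neq.
- move: (nab (o 0%N)); rewrite b0 a0 n1 n0 b3 a4 => /(_ erefl)/(_ (o 3%N)).
  rewrite b3 a4 n4 n3 b1 a1; exact: neq.
- move: (nab (o 3%N)); rewrite b3 a4 n4 n3 b0 a0 => /(_ erefl)/(_ (o 0%N)).
  rewrite b0 a0 n1 n0 b4 a5; exact: neq.
- move: (na (o 0%N)); rewrite a0 n1 n0 a5 => /(_ erefl)/(_ (o 3%N)).
  rewrite a3 n3 a2; exact: neq.
Qed.

(** * The Galois map after extension of scalars *)

Lemma galois_mapE (k : fieldType) (H L : falgType k)
    (act : 'Hom(H, 'End(L))) (u : tens L H) t :
  galois_map act u t =
    \sum_b (\sum_a (u : 'M_(_, _)) a b *: tbasis a) * act (tbasis b) t.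
Proof.
rewrite /galois_map /tlift exchange_big sum_lfunE; apply: eq_bigr => b _.
rewrite sum_lfunE mulr_suml; apply: eq_bigr => a _.
by rewrite scale_lfunE comp_lfunE lfunE /= scalerAl.
Qed.

(* The matrix [act (tbasis b) (tbasis j)] over [L] has the two-sided inverse [Q]. *)
Lemma galois_map_inverse (k : fieldType) (H : falgType k) (L : fieldExtType k)
    (act : 'Hom(H, 'End(L))) :
    bijective (galois_map act) ->
  exists Q : 'I_(dim L) -> 'I_(dim H) -> L,
    (forall j t, \sum_b Q j b * act (tbasis b) t = (v2r t 0 j)%:A) /\
    (forall b b', \sum_j act (tbasis b) (tbasis j) * Q j b' = (b == b')%:R).
Proof.
case=> g gK Kg.
pose coordf j : 'End(L) := linfun (fun t : L => v2r t 0 j *: (1 : L)).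
have coordfE j t : coordf j t = (v2r t 0 j)%:A.
  have lin : linear (fun t : L => v2r t 0 j *: (1 : L)).
    by move=> a x y; rewrite linearP !mxE scalerDl scalerA.
  pose m := GRing.isLinear.Build k L L *:%R _ lin.
  pose f : {linear L -> L} := HB.pack (fun t : L => v2r t 0 j *: (1 : L)) m.
  by rewrite -[coordf j]/(linfun f) lfunE.
(* Row [j] of [Q] is the preimage of the [j]-th coordinate function, in coordinates over [L]. *)
pose Q j b : L := \sum_a (g (coordf j) : 'M_(_, _)) a b *: tbasis a.
have Q1 j t : \sum_b Q j b * act (tbasis b) t = (v2r t 0 j)%:A.
  by rewrite -galois_mapE Kg coordfE.
exists Q; split=> // b b'.
pose U (s : 'I_(dim H) -> L) : tens L H := \matrix_(a, b) v2r (s b) 0 a.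
have UE s t : galois_map act (U s) t = \sum_b s b * act (tbasis b) t.
  rewrite galois_mapE; apply: eq_bigr => c _; congr (_ * _).
  by rewrite [RHS]tbasis_sum; apply: eq_bigr => a _; rewrite mxE.
have Uinj s s' : U s = U s' -> s =1 s'.
  move=> eqU c; apply: v2r_inj; apply/rowP => a.
  by move/matrixP/(_ a c): eqU; rewrite !mxE.
(* Row [b] of the matrix product. The Galois map sends it and the unit row to the same endomorphism
   [act (tbasis b)], so injectivity identifies them. *)
pose s c := \sum_j act (tbasis b) (tbasis j) * Q j c.
have: U s = U (fun c => (b == c)%:R).
  apply: (can_inj gK); apply/lfunP => t; rewrite !UE.
  rewrite [RHS](bigD1 b) //= eqxx mul1r.
  rewrite [X in _ + X]big1 ?addr0 => [|c]; last first.
    by rewrite eq_sym => /negPf ->; rewrite mul0r.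
  under eq_bigr do rewrite mulr_suml.
  rewrite exchange_big [in RHS](tbasis_sum t) linear_sum.
  apply: eq_bigr => j _; rewrite linearZ /=.
  under eq_bigr do rewrite -mulrA.
  by rewrite -mulr_sumr Q1 -scalerAr mulr1.
by move/Uinj/(_ b').
Qed.

(* The map [t |-> x (c t)], where [c] stands for the element
   [\sum_b c b (x) tbasis b] of [E (x) H]. *)
Definition base_act (k : fieldType) (H : falgType k) (L E : fieldExtType k)
    (act : 'Hom(H, 'End(L))) (x : L -> E) (c : 'I_(dim H) -> E) (t : L) : E :=
  \sum_b c b * x (act (tbasis b) t).

Section BaseAct.
Variables (k : fieldType) (H : falgType k) (L E : fieldExtType k).
Variables (hH : hopf_algebra H) (act : 'Hom(H, 'End(L))).
Hypothesis (actA : module_algebra hH act) (bij : bijective (galois_map act)).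
Implicit Types (x y : {lrmorphism L -> E}) (c : 'I_(dim H) -> E).
Local Notation Phi := (base_act act).

(** Applying [x] to the inverse matrix [Q] solves the linear system for [c]. *)
Lemma base_act_surj x y : exists c, Phi x c =1 y.
Proof.
have [Q [Q1 _]] := galois_map_inverse bij.
exists (fun b => \sum_j y (tbasis j) * x (Q j b)) => t; rewrite /base_act.
under eq_bigr do rewrite mulr_suml.
rewrite exchange_big {2}[t]tbasis_sum linear_sum; apply: eq_bigr => j _.
under eq_bigr do rewrite -mulrA -rmorphM.
by rewrite -mulr_sumr -rmorph_sum Q1 /= rmorph_alg -scalerAr mulr1 linearZ.
Qed.

Lemma base_act_inj x c : (forall t, Phi x c t = 0) -> forall b, c b = 0.
Proof.
have [Q [_ Q2]] := galois_map_inverse bij.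
move=> c0 b; transitivity (\sum_j Phi x c (tbasis j) * x (Q j b)); last first.
  by apply: big1 => j _; rewrite c0 mul0r.
under eq_bigr do rewrite mulr_suml.
rewrite exchange_big /= (bigD1 b) //= [X in _ + X]big1 ?addr0.
  under eq_bigr do rewrite -mulrA -rmorphM.
  by rewrite -mulr_sumr -rmorph_sum Q2 eqxx rmorph1 mulr1.
move=> b' /negPf nb; under eq_bigr do rewrite -mulrA -rmorphM.
by rewrite -mulr_sumr -rmorph_sum Q2 nb rmorph0 mulr0.
Qed.

Lemma base_act_eq x c c' : Phi x c =1 Phi x c' -> c =1 c'.
Proof.
move=> eq_c b; apply/eqP; rewrite -subr_eq0; apply/eqP.
apply: (@base_act_inj x (fun b => c b - c' b)) => t.
rewrite /base_act; under eq_bigr do rewrite mulrBl.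
by rewrite sumrB; apply/eqP; rewrite subr_eq0; apply/eqP; apply: eq_c.
Qed.

(* [Delta c = c (x) c] in [E (x) H (x) H], read off in coordinates. *)
Definition grouplike c := forall a b,
  \sum_i c i * ((comul hH (tbasis i) : 'M_(_, _)) a b)%:A = c a * c b.

Lemma base_actM x c s t :
  Phi x c (s * t) =
  \sum_a \sum_b (\sum_i c i * ((comul hH (tbasis i) : 'M_(_, _)) a b)%:A)
    * (x (act (tbasis a) s) * x (act (tbasis b) t)).
Proof.
case: actA => _ _ _ hM; rewrite /base_act.
transitivity (\sum_i \sum_a \sum_b
  c i * ((comul hH (tbasis i) : 'M_(_, _)) a b)%:A *
  (x (act (tbasis a) s) * x (act (tbasis b) t))).
  apply: eq_bigr => i _; rewrite hM /tlift rmorph_sum mulr_sumr.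
  apply: eq_bigr => a _; rewrite rmorph_sum mulr_sumr.
  apply: eq_bigr => b _.
  by rewrite /= linearZ /= rmorphM -mulrA mulr_algl.
rewrite exchange_big; apply: eq_bigr => a _.
rewrite exchange_big; apply: eq_bigr => b _.
by rewrite mulr_suml.
Qed.

Lemma base_act_mul x c s t :
  Phi x c s * Phi x c t =
  \sum_a \sum_b (c a * c b) * (x (act (tbasis a) s) * x (act (tbasis b) t)).
Proof.
rewrite mulr_suml; apply: eq_bigr => a _; rewrite mulr_sumr.
by apply: eq_bigr => b _; rewrite mulrACA.
Qed.

(** Multiplicativity compares two coefficient families, [Delta c] and the products [c a * c b]. For
    the converse, [base_act_eq] is applied once in each of the variables [s] and [t]. *)
Lemma grouplike_base_act x c :
  grouplike c <-> {morph Phi x c : s t / s * t}.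
Proof.
split=> [gc s t | mc a b].
  rewrite base_actM base_act_mul.
  by apply: eq_bigr => a _; apply: eq_bigr => b _; rewrite gc.
pose D a b := \sum_i c i * ((comul hH (tbasis i) : 'M_(_, _)) a b)%:A.
suff D0 t : (fun a => Phi x (D a) t) =1 (fun a => Phi x (fun b => c a * c b) t).
  by apply: (@base_act_eq x (D a) (fun b => c a * c b)) => t; apply: D0.
apply: (@base_act_eq x) => s.
have := mc s t; rewrite base_actM base_act_mul => e.
rewrite /base_act; under eq_bigr do rewrite mulr_suml.
under [RHS]eq_bigr do rewrite mulr_suml.
transitivity (\sum_a \sum_b D a b *
    (x (act (tbasis a) s) * x (act (tbasis b) t))).
  by do 2 (apply: eq_bigr => ? _); rewrite -mulrA [X in _ * X = _]mulrC.
rewrite {}e; do 2 (apply: eq_bigr => ? _).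
by rewrite -!mulrA; congr (_ * (_ * _)); rewrite mulrC.
Qed.

Lemma base_act1 x c :
  Phi x c 1 = \sum_i c i * (counit hH (tbasis i))%:A.
Proof.
case: actA => _ _ h1 _; apply: eq_bigr => i _.
by rewrite h1 linearZ /= rmorph1.
Qed.

Lemma base_act_linear x c : linear (Phi x c).
Proof.
move=> a s t; rewrite /base_act scaler_sumr -big_split; apply: eq_bigr => b _.
by rewrite !linearP /= mulrDr -scalerAr.
Qed.

Lemma base_act_id : exists c, forall x, Phi x c =1 x.
Proof.
case: actA => h1 _ _ _; exists (fun b => (v2r (1 : H) 0 b)%:A) => x t.
rewrite /base_act -{2}[t]h1 {2}[1]tbasis_sum linear_sum sum_lfunE rmorph_sum.
apply: eq_bigr => b _.
by rewrite linearZ /= scale_lfunE linearZ /= mulr_algl.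
Qed.

Lemma base_act_comp x x' c (g : {lrmorphism E -> E}) :
  x' =1 g \o x -> Phi x' (g \o c) =1 g \o Phi x c.
Proof.
move=> x'E t; rewrite /base_act /= rmorph_sum.
by apply: eq_bigr => b _; rewrite x'E rmorphM.
Qed.

(** Being grouplike and having counit 1 do not involve the embedding, so both pass from [x] to
    [x']. *)
Lemma base_act_hom x y x' c :
  Phi x c =1 y -> exists y' : {lrmorphism L -> E}, Phi x' c =1 y'.
Proof.
move=> cE.
have gc : grouplike c.
  by apply/(grouplike_base_act x) => s t; rewrite !cE rmorphM.
have mm : monoid_morphism (Phi x' c).
  split; last by apply/grouplike_base_act.
  by rewrite base_act1 -(base_act1 x) cE rmorph1.
pose l := GRing.isLinear.Build k L E *:%R _ (base_act_linear x' c).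
pose m := GRing.isMonoidMorphism.Build L E _ mm.
by exists (HB.pack_for {lrmorphism L -> E} (Phi x' c) l m).
Qed.

End BaseAct.

(** * The sharply transitive family of a Hopf Galois structure *)

Lemma hopf_galois_regular_family (k : fieldType) (H : falgType k)
    (L E : fieldExtType k) (hH : hopf_algebra H) (act : 'Hom(H, 'End(L)))
    (I : finType) (e : I -> {lrmorphism L -> E}) :
    module_algebra hH act -> bijective (galois_map act) ->
    (forall i j, e i =1 e j -> i = j) ->
    (forall y : {lrmorphism L -> E}, exists i, y =1 e i) ->
  exists N : (I -> I) -> Prop,
    [/\ forall i j, exists2 n, N n & n i = j,
        forall n n' i, N n -> N n' -> n i = n' i -> n =1 n',
        N id
      & forall (g : {lrmorphism E -> E}) (s : {perm I}),
          (forall i, e (s i) =1 g \o e i) ->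
        forall n, N n -> exists2 n', N n' & forall i, n' (s i) = s (n i)].
Proof.
move=> actA bij e_inj e_full.
exists (fun n => exists c, forall i, base_act act (e i) c =1 e (n i)).
split=> [i j | n n' i [c cE] [c' c'E] nn' l | | g s es n [c cE]].
- have [c cE] := base_act_surj bij (e i) (e j).
  have /fin_all_exists[n nE] l : exists m, base_act act (e l) c =1 e m.
    have [y yE] := base_act_hom actA bij (e l) cE.
    by have [m ym] := e_full y; exists m => t; rewrite yE ym.
  by exists n; [exists c | apply: e_inj => t; rewrite -nE cE].
- have cc' : c =1 c'.
    by apply: (base_act_eq bij (x := e i)) => t; rewrite cE c'E nn'.
  by apply: e_inj => t; rewrite -cE -c'E; apply: eq_bigr => b _; rewrite cc'.
- by have [c cE] := base_act_id E actA; exists c.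
(* Galois action on coefficients: [g \o c] induces the conjugate of [n] by [s]. *)
- exists (fun i => s (n ((s^-1)%g i))); last by move=> i; rewrite permK.
  exists (g \o c) => i t; rewrite es /= -cE.
  by apply: base_act_comp => u; rewrite -es permKV.
Qed.

(** * Embeddings of [K] as cosets of Galois groups *)

Lemma subfield_embedding_gal (k : fieldType) (M : splittingFieldType k)
    (K : {subfield M}) (y : {lrmorphism subvs_of K -> M}) :
    galois 1 {:M} ->
  exists2 g, g \in 'Gal({:M} / 1) & forall t, y t = g (vsval t).
Proof.
move=> /and3P[_ _ nM].
(* [kHom_to_gal] takes an endomorphism of [M]; only the values of [f] on [K] matter. *)
pose f : 'End(M) := linfun (y \o vsproj K).
have fE u : f u = y (vsproj K u) by rewrite lfunE.
have f_hom : kHom 1 K f.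
  apply/kHomP_tmp; split=> [u /vlineP[a ->] | u v Ku Kv]; rewrite !fE.
    have -> : vsproj K a%:A = a%:A.
      by apply: val_inj; rewrite /= algid1 vsprojK ?rpredZ ?rpred1.
    by rewrite linearZ /= rmorph1.
  rewrite -rmorphM; congr (y _); apply: val_inj.
  by rewrite /= !vsprojK ?rpredM.
have sub : (1 <= K <= {:M})%VS by rewrite sub1v subvf.
have [g Gg gE] := kHom_to_gal sub nM f_hom.
exists g => // t; rewrite -gE ?subvsP // fE.
by congr (y _); apply: val_inj; rewrite /= vsprojK ?subvsP.
Qed.

Lemma gal_eq_on_subfield (k : fieldType) (M : splittingFieldType k)
    (K : {subfield M}) (g h : gal_of {:M}) :
  {in K, g =1 h} <-> g \in ('Gal({:M} / K) :* h)%g.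
Proof.
have KM : (K <= {:M})%VS by rewrite subvf.
split=> [gh | /rcosetP[u uK ->] a Ka]; last first.
  by rewrite galM ?memvf // (fixed_gal KM uK).
rewrite mem_rcoset gal_kHom //; apply/kHomP_tmp; split=> [a Ka | a b _ _].
  by rewrite galM ?memvf // gh // -galM ?memvf // mulgV gal_id.
by rewrite rmorphM.
Qed.

Theorem proposition4p3 (k : fieldType) (Kt : splittingFieldType k)
    (K : {subfield Kt}) :
  separable 1 K -> \dim K = 6%N ->
  is_galois_closure K ->
  galois_perm_group_is K F36 ->
  ~ hopf_galois (subvs_of K).
Proof.
move=> _ _ [galKt _] [f [f_inj f_im F36E]] [H [hH [act [_ actA bij]]]].
pose e i : {lrmorphism subvs_of K -> Kt} := repr (f i) \o vsval.
have f_coset i g : g \in f i -> f i = ('Gal({:Kt} / K) :* g)%g.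
  have: f i \in f @: [set: 'I_6] by apply: imset_f.
  by rewrite f_im => /rcosetsP[h _ ->] /rcoset_eqP ->.
have fi_repr i : repr (f i) \in f i.
  have: f i \in f @: [set: 'I_6] by apply: imset_f.
  by rewrite f_im => /rcosetsP[h _ ->]; apply: mem_repr_rcoset.
have eE i g : g \in f i -> forall t, e i t = g (vsval t).
  move=> /f_coset fiE t; rewrite /e /=.
  have := fi_repr i; rewrite {2}fiE => /gal_eq_on_subfield; apply.
  exact: subvsP.
have e_inj i j : e i =1 e j -> i = j.
  move=> eij; apply: f_inj; rewrite (f_coset _ _ (fi_repr j)).
  apply: (f_coset); rewrite (f_coset _ _ (fi_repr i)).
  apply/gal_eq_on_subfield => a Ka.
  by have := esym (eij (vsproj K a)); rewrite /e /= vsprojK.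
have e_full (y : {lrmorphism subvs_of K -> Kt}) : exists i, y =1 e i.
  have [g Gg gE] := subfield_embedding_gal y galKt.
  have: ('Gal({:Kt} / K) :* g)%g \in f @: [set: 'I_6].
    by rewrite f_im; apply/rcosetsP; exists g.
  case/imsetP=> i _ fi; exists i => t; rewrite gE (eE i g) //.
  by rewrite -fi rcoset_refl.
have [N [Ntrans Nfree Nid Nconj]] :=
  hopf_galois_regular_family actA bij e_inj e_full.
apply: (F36_no_regular_family Ntrans Nfree Nid) => s n /F36E[g _ fs].
(* The product [repr (f i) * g] applies [g] last, so right translation of the coset by [g] composes
   [e i] with [g]. *)
apply: (Nconj g) => i t; rewrite (eE _ (repr (f i) * g)%g) ?galM ?memvf //.
by rewrite fs /= rcosetE; apply/rcosetP; exists (repr (f i)).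
Qed.
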